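(* Suppose that $(m_k)_{k=1}^\infty$ and $(n_k)_{k=1}^\infty$ are strictly increasing sequences of positive integers. For each $k\in\mathbb{N}$ define $\Lambda_k=2^{-m_k}\mathbb{N}\cap[n_k,n_{k+1})$ and let $\Lambda=\bigcup_{k=1}^\infty\Lambda_k$. Define $M=\sup_k\{m_{k+1}-m_k\}$. Then $\Lambda$ is type 1 if and only if $M<\infty$.
   Context: Here $\mathbb{N}=\{1,2,\dots\}$ and $2^{-m}\mathbb{N}=\{2^{-m}j: j\in\mathbb{N}\}$. A set $\Lambda\subset\mathbb{R}$ is called admissible if it is countably infinite, unbounded, bounded from below, and has no finite accumulation points. Let $\mu$ denote Lebesgue measure on $\mathbb{R}$. For an admissible $\Lambda$ and a (Lebesgue) measurable $f:\mathbb{R}\to[0,+\infty)$, put $s(x)=\sum_{\lambda\in\Lambda}f(x+\lambda)$, $C(f,\Lambda)=\{x\in\mathbb{R}: s(x)<\infty\}$ and $D(f,\Lambda)=\{x\in\mathbb{R}: s(x)=\infty\}$. The set $\Lambda$ is type 1 if for every measurable $f:\mathbb{R}\to[0,+\infty)$ either $\mu(D(f,\Lambda))=0$ or $\mu(C(f,\Lambda))=0$. Otherwise $\Lambda$ is type 2. *)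

(* Defs.v *)
From mathcomp Require Import all_boot all_order all_algebra.
From mathcomp Require Import all_classical all_reals all_analysis.

Set Implicit Arguments.
Unset Strict Implicit.
Unset Printing Implicit Defensive.
Import Order.TTheory GRing.Theory Num.Theory.
Import numFieldNormedType.Exports.

Local Open Scope classical_set_scope.
Local Open Scope ring_scope.

Definition admissible (R : realType) (L : set R) : Prop :=
  [/\ countable L, infinite_set L, ~ bounded_set L, has_lbound L
    & limit_point L = set0].

(* The real line with the sigma-algebra of Lebesgue measurable sets, i.e. the
   domain of [completed_lebesgue_measure]; [measurableTypeR R] is the real line
   with its Borel sets. *)
Notation lebesgueTypeR R := (caratheodory_type ((@wlength R idfun)^*)%mu).

Definition lebesgue_measurable_fun (R : realType) (f : R -> R) : Prop :=
  measurable_fun [set: lebesgueTypeR R]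
    (f : lebesgueTypeR R -> measurableTypeR R).

Definition translate_sum (R : realType) (f : R -> R) (L : set R) (x : R) :
    \bar R :=
  (\esum_(l in L) (f (x + l))%:E)%E.

Definition conv_set (R : realType) (f : R -> R) (L : set R) : set R :=
  [set x | (translate_sum f L x < +oo)%E].

Definition div_set (R : realType) (f : R -> R) (L : set R) : set R :=
  [set x | translate_sum f L x = +oo%E].

(* Type 1 is a property of admissible sets only; the sets [Lambda] below are
   always admissible when [m] and [n] are strictly increasing. *)
Definition type1 (R : realType) (L : set R) : Prop :=
  admissible L /\
  forall f : R -> R, (forall x, 0 <= f x) -> lebesgue_measurable_fun f ->
    completed_lebesgue_measure (div_set f L) = 0%E \/
    completed_lebesgue_measure (conv_set f L) = 0%E.

Definition dyadic_pos (R : realType) (m : nat) : set R :=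
  [set 2 ^- m * j%:R | j in [set j : nat | (0 < j)%N]].

(* Sequences (m_k), (n_k) with k = 1, 2, ... are encoded as functions on [nat]
   with m_k = m k.-1 and n_k = n k.-1. *)
Definition Lambda_block (R : realType) (m n : nat -> nat) (k : nat) : set R :=
  dyadic_pos (m k) `&` `[(n k)%:R, (n k.+1)%:R[%classic.

Definition Lambda (R : realType) (m n : nat -> nat) : set R :=
  \bigcup_k Lambda_block m n k.

Definition sup_gap (R : realType) (m : nat -> nat) : \bar R :=
  ereal_sup (range (fun k => ((m k.+1)%:R - (m k)%:R : R)%:E)).

(* Main.v *)
Require Import Defs.
From HB Require Import structures.
From mathcomp Require Import all_boot all_order all_algebra.
From mathcomp Require Import finmap all_classical all_reals all_analysis.
From mathcomp Require Import measurable_realfun.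
From mathcomp Require Import ring lra zify.
Set Implicit Arguments.
Unset Strict Implicit.
Unset Printing Implicit Defensive.
Import Order.TTheory GRing.Theory Num.Theory.
Import numFieldNormedType.Exports.
Local Open Scope classical_set_scope.
Local Open Scope ring_scope.

(** Write [s x] for the sum of [f (x + l)] over [l] in [Lambda], [C] for the set
where it is finite and [D] for its complement.  The lattices [2^-p Z] get finer
as one moves to the right along [Lambda], so translating [Lambda] to the right
by a nonnegative dyadic [t] moves all but finitely many of its points to points
of [Lambda]: the set [C] is stable under [x |-> x + t] ([conv_set_shift]).
Everything depends on whether [C] is also stable, up to a null set, under
translation to the left.

Suppose that the gaps [m_(k+1) - m_k] are at most [M].  Compare [s x] with
[s (x + 1/2)].  The only terms of the first sum that the second one lacks, apart
from finitely many, sit just after the points [n_(k+1)], where the first sum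
runs over the lattice of mesh [2^-m_(k+1)] and the second one over that of mesh
[2^-m_k].  Let [h_k x] be the sum of [f] over the points of [x + 2^-m_k Z] in a
window of length 1 at [n_(k+1)].  It has period [2^-m_k], and the sum over the
finer lattice is the sum of the [2^(m_(k+1) - m_k)] translates of [h_k] by
multiples of [2^-m_(k+1)].  So one has to show that for almost every [x] the
convergence of the series of the [h_k] implies that of the series of the refined
sums ([negligible_refined_series_dvg]).  This is a conditional Borel-Cantelli
lemma for the decreasing filtration of the sigma-algebras of
[2^-m_k]-periodic sets, for which conditional expectation is the average over
translates.  If [loss k] is the average over these translates of
[1 - exp (- h_k)], then the product of the factors [exp (loss k - h_k)] over
[k < N] has integral at most 1 over every interval of length 1: peel off the
first factor, average it over translates that leave the other factors unchanged,
and use [1 - y <= exp (- y)].  By Fatou's lemma the products almost everywhere do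
not tend to infinity; where the series of the [h_k] converges, this forces the
series of the [loss k] to converge.  As at most [2^M] translates are averaged,
the refined series converges there as well.

Hence, up to a null set, [C] is invariant under all dyadic translations.  By
Lebesgue's density theorem an invariant measurable set is null or conull
([dyadic_zero_one]), because it has the same density in all intervals of length
[2^-p].  This gives type 1 for Borel [f]; a Lebesgue measurable [f] becomes Borel
when it is set to 0 on a suitable null set, and this changes [s] only on a null
set.

Suppose that the gaps are unbounded.  Choose [k_j] with
[m_(k_j + 1) - m_(k_j) >= j + 3], and let [f] be the indicator of the union of
the intervals of length [2^-m_(k_j + 1)] that start at [n_(k_j + 1)].  If
[x <= 0] then [x + Lambda] meets each of them, because [Lambda] has mesh
[2^-m_(k_j + 1)] or finer from [n_(k_j + 1)] on, so that [s x] is infinite.  If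
[1 <= x < 2] then [x + Lambda] reaches the interval only through points of
[2^-m_(k_j) Z], which happens only for [x] in a set of measure at most
[2^-(j + 2)].  These measures add up to at most 1/2, so [s] vanishes on a subset
of [[1, 2)] of positive measure. *)

(** * Sums over translates of a set *)

Section translate_sums.
Context {R : realType}.
Implicit Types (f g : R -> R) (L A B : set R) (x t : R).

Lemma translate_sum_le f L A x : (forall y, 0 <= f y) -> L `<=` A ->
  (translate_sum f L x <= translate_sum f A x)%E.
Proof.
move=> f0 LA; rewrite /translate_sum esum_mkcond [leRHS]esum_mkcond.
apply: le_esum => l _; case: ifPn => lL; last by case: ifPn; rewrite ?lee_fin.
by rewrite ifT// inE; apply: LA; exact: set_mem.
Qed.

Lemma translate_sum_ge0 f L x : (forall y, 0 <= f y) ->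
  (0 <= translate_sum f L x)%E.
Proof. by move=> f0; apply: esum_ge0 => l _; rewrite lee_fin. Qed.

Lemma translate_sumU f A B x : (forall y, 0 <= f y) ->
  (translate_sum f (A `|` B) x <=
   translate_sum f A x + translate_sum f B x)%E.
Proof.
move=> f0; rewrite {1}/translate_sum (esumID A); last first.
  by move=> l _; rewrite lee_fin.
apply: leeD; apply: translate_sum_le => // l [].
by move=> [].
Qed.

Lemma translate_sum_bigcup_ord f (B : nat -> set R) n x : (forall y, 0 <= f y) ->
  (translate_sum f (\bigcup_(i < n) B i) x <=
   \sum_(i < n) translate_sum f (B i) x)%E.
Proof.
move=> f0; elim: n => [|n IH].
  by rewrite bigcup_mkord big_ord0 big_ord0 /translate_sum esum_set0.
rewrite bigcup_mkord !big_ord_recr/= -bigcup_mkord.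
exact: le_trans (translate_sumU _ _ _ f0) (leeD _ _).
Qed.

Lemma translate_sum_bigcup f (B : nat -> set R) x : (forall y, 0 <= f y) ->
  trivIset setT B ->
  (translate_sum f (\bigcup_k B k) x = \sum_(k <oo) translate_sum f (B k) x)%E.
Proof.
move=> f0 tB; rewrite /translate_sum esum_bigcupT//.
  by rewrite nneseries_esumT// => k; exact: translate_sum_ge0.
by move=> l; rewrite lee_fin.
Qed.

Lemma translate_sum_finite f L x : (forall y, 0 <= f y) -> finite_set L ->
  (translate_sum f L x < +oo)%E.
Proof.
move=> f0 fL; rewrite /translate_sum esum_fset//.
  by rewrite fsumEFin// ltry.
by move=> l _; rewrite lee_fin.
Qed.

Lemma translate_sum_shift f L x t :
  translate_sum f L (x + t) = translate_sum f ((fun l => t + l) @` L) x.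
Proof.
rewrite /translate_sum esum_image; last by move=> a b _ _ /addrI.
by apply: eq_esum => l _; rewrite addrA.
Qed.

Lemma translate_sum_restrict f (J : set R) L x :
  translate_sum (fun y => f y * \1_J y) L x =
  translate_sum f (L `&` [set l | J (x + l)]) x.
Proof.
rewrite /translate_sum esum_mkcondr; apply: eq_esum => l _.
rewrite indicE; have -> : (x + l \in J) = (l \in [set l | J (x + l)]).
  by apply/idP/idP; rewrite !inE.
by case: ifP; rewrite ?mulr1 ?mulr0.
Qed.

(** An enumeration of [L] turns the sum into a series of nonnegative functions. *)
Lemma measurable_translate_sum f L : (forall y, 0 <= f y) -> countable L ->
  measurable_fun setT f -> measurable_fun setT (translate_sum f L).
Proof.
move=> f0 /countable_injP[g ginj] mf.
(* An inverse on [g @` L] of the injection [g] of [L] into the naturals. *)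
pose e := 'pinv_(fun=> 0) L g.
have eK : {in L, cancel g e} by move=> l lL; exact: pinvKV.
have gL : set_bij (g @` L) L e.
  split.
  - by move=> _ [l lL <-]; rewrite eK ?inE.
  - by move=> ? ? /[!inE] -[a aL <-] [b bL <-]; rewrite !eK ?inE// => ->.
  - by move=> l lL; exists (g l); [exists l|rewrite eK ?inE].
have -> : translate_sum f L = fun x =>
    (\sum_(k <oo | k \in g @` L) (f (x + e k))%:E)%E.
  apply/funext => x; rewrite /translate_sum (reindex_esum _ _ _ _ gL).
  by rewrite nneseries_esum ?set_mem_set// => k _; rewrite lee_fin.
apply: ge0_emeasurable_sum => [k x _ _|k _]; first by rewrite lee_fin.
apply/measurable_EFinP; apply: measurableT_comp => //.
by apply: measurable_funD.
Qed.

End translate_sums.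

(** * Dyadic lattices and the set Lambda *)

(** The group [2^-p Z].  The positive dyadics of a block of [Lambda] are replaced
by this group because it is stable under differences. *)
Definition lattice (R : realType) (p : nat) : set R :=
  [set x | x * 2 ^+ p \is a Num.int].
Arguments lattice {R} p.

Section lattices.
Context {R : realType}.
Implicit Types (p q : nat) (x y : R).

Lemma latticeD p x y : lattice p x -> lattice p y -> lattice p (x + y).
Proof. by rewrite /lattice /= mulrDl => xp yp; rewrite rpredD. Qed.

Lemma latticeN p x : lattice p x -> lattice p (- x).
Proof. by rewrite /lattice /= mulNr rpredN. Qed.

Lemma latticeB p x y : lattice p x -> lattice p y -> lattice p (x - y).
Proof. by move=> xp yp; exact/latticeD/latticeN. Qed.

Lemma sub_lattice p q : (p <= q)%N -> (lattice p : set R) `<=` lattice q.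
Proof.
move=> pq x; rewrite /lattice /= => xp.
by rewrite -(subnKC pq) exprD mulrA rpredM// -natrX; exact: natr_int.
Qed.

Lemma lattice_ratio p (z : int) : lattice p (z%:~R / 2 ^+ p : R).
Proof. by rewrite /lattice /= divfK ?expf_neq0. Qed.

Lemma lattice_step p : lattice p (2 ^- p : R).
Proof. by rewrite -div1r; exact: (lattice_ratio p 1). Qed.

Lemma lattice_int p (z : int) : lattice p (z%:~R : R).
Proof. by rewrite /lattice /= -natrX rpredM //; [exact: intr_int|exact: natr_int]. Qed.

Lemma latticeP p x : lattice p x -> exists z : int, x = z%:~R / 2 ^+ p.
Proof.
by move=> /intrP[z xz]; exists z; rewrite -xz mulfK// expf_neq0.
Qed.

Lemma lattice_shift p t : lattice p t ->
  (fun l => t + l) @` lattice p = lattice p :> set R.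
Proof.
move=> pt; apply/seteqP; split=> [_ [l pl <-]|l pl]; first exact: latticeD.
by exists (l - t); [exact: latticeB|rewrite addrC subrK].
Qed.

Lemma countable_lattice p : countable (lattice p : set R).
Proof.
apply: (@sub_countable _ _ _ (range (fun z : int => z%:~R / 2 ^+ p : R))).
  by apply: subset_card_le => x /latticeP[z ->]; exists z.
by apply: sub_countable (card_image_le _ _) _.
Qed.

Lemma finite_lattice p a b : finite_set (lattice p `&` `[a, b] : set R).
Proof.
have p0 : 0 < 2 ^+ p :> R by rewrite exprn_gt0.
set c : int := Num.floor (a * 2 ^+ p).
set d : nat := `|Num.ceil ((b - a) * 2 ^+ p)|.+2.
apply: (@sub_finite_set _ _ ((fun i => (c%:~R + i%:R) / 2 ^+ p) @` `I_d));
  last exact: finite_image.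
move=> x [/latticeP[z ->]] /=; rewrite in_itv/= => /andP[az zb].
have cz : (c <= z)%R.
  rewrite -(ler_int R); apply: le_trans (floor_le _) _.
  by rewrite -ler_pdivlMr.
exists `|z - c|%N; last first.
  by rewrite natr_absz ger0_norm ?subr_ge0// intrB addrC subrK.
have : (z - c)%:~R < (d%:Z)%:~R :> R.
  have h1 : z%:~R <= b * 2 ^+ p by rewrite -ler_pdivrMr.
  have h2 : a * 2 ^+ p < (c + 1)%:~R by exact: floorD1_gt.
  have h3 : (b - a) * 2 ^+ p <= (Num.ceil ((b - a) * 2 ^+ p))%:~R by exact: ceil_ge.
  have h4 : (Num.ceil ((b - a) * 2 ^+ p))%:~R <=
            `|Num.ceil ((b - a) * 2 ^+ p)|%N%:R :> R.
    by rewrite natr_absz ler_int ler_norm.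
  have hd : d%:~R = `|Num.ceil ((b - a) * 2 ^+ p)|%N%:R + 2 :> R.
    by rewrite /d -addn2 -pmulrn natrD.
  rewrite hd intrB; move: h1 h2 h3 h4; rewrite intrD; lra.
rewrite ltr_int => zd /=; lia.
Qed.

End lattices.

Section Lambda.
Context {R : realType} (m n : nat -> nat).
Hypothesis n_pos : forall k, (0 < n k)%N.
Hypothesis m_incr : {homo m : i j / (i < j)%N}.
Hypothesis n_incr : {homo n : i j / (i < j)%N}.
Local Notation L := (Lambda m n : set R).

Lemma leq_of_homo_ltn (u : nat -> nat) : {homo u : i j / (i < j)%N} ->
  forall k, (k <= u k)%N.
Proof.
by move=> u_incr; elim=> // k /leq_ltn_trans; apply; apply: u_incr.
Qed.

Lemma Lambda_blockE k (l : R) :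
  Lambda_block m n k l <-> lattice (m k) l /\ (n k)%:R <= l < (n k.+1)%:R.
Proof.
rewrite /Lambda_block /dyadic_pos /=; split=> -[].
  move=> [j j0 <-] /=; rewrite in_itv/= => ->; split=> //.
  by rewrite mulrC; exact: (lattice_ratio (m k) j).
move=> /latticeP[z ->] nl; split; last by rewrite in_itv.
have : (0 < z)%R.
  case/andP: nl => nl _.
  have : 0 < z%:~R / 2 ^+ m k :> R by apply: lt_le_trans nl; rewrite ltr0n.
  by rewrite pmulr_lgt0 ?invr_gt0 ?exprn_gt0// ltr0z.
by case: z {nl} => // z z0; exists z => //; rewrite mulrC.
Qed.

(** As the lattices are nested and get finer with [k], a point of [2^-m_k Z] beyond
[n_(k+1)] lies in the lattice of a later block. *)
Lemma LambdaP (l : R) :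
  L l <-> exists2 k, lattice (m k) l & (n k)%:R <= l.
Proof.
split=> [[k _ /Lambda_blockE[kl /andP[nl _]]]|[k kl nl]]; first by exists k.
have lN : exists N, l < (n N)%:R.
  exists (Num.bound l); apply: lt_le_trans (archi_boundP _) _.
    exact: le_trans nl.
  by rewrite ler_nat leq_of_homo_ltn.
have [[|N] lN' Nmin] := ex_minnP lN.
  have := le_lt_trans nl lN'; rewrite ltr_nat => /(leq_ltn_trans _) nn.
  by have := nn (n 0) (ltnW_homo n_incr (leq0n k)); rewrite ltnn.
have Nl : (n N)%:R <= l.
  by rewrite leNgt; apply/negP => /Nmin; rewrite ltnn.
exists N => //; apply/Lambda_blockE; split; last by rewrite Nl.
apply: sub_lattice kl; apply: (ltnW_homo m_incr).
rewrite -ltnS ltnNge; apply/negP => Nk.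
have := le_lt_trans nl lN'; rewrite ltr_nat ltnNge => /negP; apply.
exact: ltnW_homo n_incr _ _ Nk.
Qed.

Lemma Lambda_ge1 (l : R) : L l -> 1 <= l.
Proof.
by move=> /LambdaP[k _]; apply: le_trans; rewrite ler1n.
Qed.

Lemma Lambda_lattice b (l : R) : L l -> l <= b%:R -> lattice (m b) l.
Proof.
move=> /LambdaP[k kl nl] lb; apply: sub_lattice kl.
apply: (ltnW_homo m_incr).
have := le_trans nl lb; rewrite ler_nat; apply: leq_trans.
exact: leq_of_homo_ltn.
Qed.

Lemma finite_Lambda (b : R) : finite_set (L `&` [set l | l <= b]).
Proof.
set N := Num.bound b.
apply: (@sub_finite_set _ _ (lattice (m N) `&` `[0, N%:R] : set R));
  last exact: finite_lattice.
move=> l [Ll /= lb].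
have l0 : 0 <= l by exact: le_trans (Lambda_ge1 Ll).
have lN : l <= N%:R.
  exact: le_trans lb (ltW (archi_boundP (le_trans l0 lb))).
by split; [exact: Lambda_lattice lN|rewrite /= in_itv/= l0 lN].
Qed.

Lemma countable_Lambda : countable L.
Proof.
apply: bigcup_countable => // k _.
apply: (@sub_countable _ _ _ (lattice (m k) : set R)).
  by apply: subset_card_le => l /Lambda_blockE[].
exact: countable_lattice.
Qed.

Lemma Lambda_nat k : L (n k)%:R.
Proof. by apply/LambdaP; exists k => //; exact: (lattice_int _ (n k)). Qed.

Lemma admissible_Lambda : admissible L.
Proof.
split.
- exact: countable_Lambda.
- apply/infiniteP/pcard_leP/injfunPex.
  exists (fun k => (n k)%:R) => [k _|k k' _ _ /eqP]; first exact: Lambda_nat.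
  rewrite eqr_nat => /eqP nxy; apply/eqP; rewrite eqn_leq.
  by apply/andP; split; rewrite leqNgt; apply/negP => /n_incr; rewrite nxy ltnn.
- move=> [M [_ /(_ (M + 1))]]; rewrite ltrDl ltr01 => /(_ erefl) bL.
  set N := Num.bound (M + 1).
  have := bL _ (Lambda_nat N); rewrite /= normr_nat leNgt => /negP; apply.
  have M0 : 0 <= M + 1 by exact: le_trans (bL _ (Lambda_nat 0)).
  by apply: lt_le_trans (archi_boundP M0) _; rewrite ler_nat leq_of_homo_ltn.
- by exists 1 => l; exact: Lambda_ge1.
- rewrite -subset0 => x /limit_point_infinite_setP /(_ [set y | y < x + 1]).
  apply; first by apply: lt_nbhsl; rewrite ltrDl.
  by apply: sub_finite_set (finite_Lambda (x + 1)) => y [/= /ltW].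
Qed.

(** A block whose lattice contains [t] is mapped into [Lambda] by the translation;
the other blocks have index below [p], as [k <= m_k], and so end before [n_p]. *)
Lemma Lambda_shift_sub p t : lattice p t -> 0 <= t ->
  (fun l => t + l) @` L `<=`
  L `|` (fun l => t + l) @` (L `&` [set l | l <= (n p)%:R]).
Proof.
move=> pt t0 _ [l Ll <-].
have [lp|lp] := leP l (n p)%:R; first by right; exists l.
left; have /LambdaP[k kl nl] := Ll; apply/LambdaP; exists (maxn k p).
  apply: latticeD.
    apply: sub_lattice pt; apply: leq_trans (leq_maxr k p) _.
    exact: leq_of_homo_ltn.
  by apply: sub_lattice kl; exact: ltnW_homo m_incr _ _ (leq_maxl _ _).
rewrite -[leLHS]add0r lerD// /maxn; case: ifP => // _; exact: ltW.
Qed.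

End Lambda.

(** * Translations and periodic functions *)

Section translation.
Context {R : realType}.
Notation mu := (@lebesgue_measure R).

Lemma measurable_shift (t : R) : measurable_fun [set: R] (fun x => x + t).
Proof. exact: measurable_funD. Qed.

Lemma lebesgue_measure_shift (t : R) (A : set R) : measurable A ->
  mu [set x | A (x + t)] = mu A.
Proof.
move=> mA.
have mphi : measurable_fun setT
    (fun x : measurableTypeR R => (x + t : measurableTypeR R)).
  exact: measurable_shift.
(* The bundled function makes the pushforward a measure, as uniqueness requires. *)
pose phi : {mfun measurableTypeR R >-> measurableTypeR R} :=
  HB.pack (fun x : measurableTypeR R => (x + t : measurableTypeR R))
   (isMeasurableFun.Build _ _ _ _ _ mphi).
apply/esym; rewrite -[RHS]/(pushforward mu phi A).
apply: lebesgue_measure_unique => // _ [[a b]] _ <-.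
rewrite [RHS](_ : _ = mu `]a - t, b - t]); last first.
  congr (mu _); apply/seteqP; split=> x /=; rewrite !in_itv/= => /andP[]; lra.
rewrite !lebesgue_measure_itv/= !lte_fin ltrD2r; case: ifP => // _.
by rewrite -!EFinB; congr EFin; lra.
Qed.

Lemma negligible_shift (t : R) (A : set R) : mu.-negligible A ->
  mu.-negligible [set x | A (x + t)].
Proof.
move=> [B [mB B0 AB]]; exists [set x | B (x + t)]; split.
- by rewrite -[X in measurable X]setTI; exact: measurable_shift.
- by rewrite lebesgue_measure_shift.
- by move=> x /AB.
Qed.

Lemma integral_shift (u : R -> \bar R) (b c t : R) :
  measurable_fun setT u -> (forall x, (0 <= u x)%E) ->
  (\int[mu]_(x in `[(b + t)%R, (c + t)%R[) u x =
   \int[mu]_(x in `[b, c[) u (x + t)%R)%E.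
Proof.
move=> mu_ u0.
pose phi (x : measurableTypeR R) : measurableTypeR R := x + t.
have mphi : measurable_fun setT phi by exact: measurable_shift.
have -> : `[b, c[%classic = phi @^-1` `[b + t, c + t[%classic.
  by apply/seteqP; split=> x; rewrite /phi /= !in_itv/= => /andP[]; lra.
rewrite -(ge0_integral_pushforward mphi mu (f := u))//=.
- by apply: eq_measure_integral => A mA _; exact/esym/lebesgue_measure_shift.
- exact: measurable_funTS.
Qed.

Lemma ge0_integral_itvco_split (u : R -> \bar R) (a b c : R) :
  measurable_fun setT u -> (forall x, (0 <= u x)%E) -> a <= b -> b <= c ->
  (\int[mu]_(x in `[a, c[) u x =
   \int[mu]_(x in `[a, b[) u x + \int[mu]_(x in `[b, c[) u x)%E.
Proof.
move=> mu_ u0 ab bc.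
have -> : `[a, c[%classic = `[a, b[ `|` `[b, c[ :> set R.
  apply/seteqP; split=> x /=; rewrite !in_itv/=.
    by move=> /andP[-> ->]; rewrite andbT/=; case: (ltP x b); [left|right].
  by case=> /andP[]; lra.
rewrite ge0_integral_setU//; first exact: measurable_funTS.
by apply/disj_setPS => x /= []; rewrite !in_itv/= => /andP[_ xb] /andP[]; lra.
Qed.

Lemma periodic_intmul (T : Type) (u : R -> T) (w : R) (z : int) (x : R) :
  (forall x, u (x + w) = u x) -> u (x + w *~ z) = u x.
Proof.
move=> uw.
have un k y : u (y + w *+ k) = u y.
  by elim: k => [|k IH]; rewrite ?mulr0n ?addr0// mulrSr addrA uw.
case: z => k; first exact: un.
by rewrite NegzE mulrNz -[LHS](un k.+1) subrK.
Qed.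

(** Both intervals can be moved by multiples of the period until they overlap;
the two parts outside the overlap then differ by one period. *)
Lemma integral_periodic (u : R -> \bar R) (w b c : R) : 0 < w ->
  measurable_fun setT u -> (forall x, (0 <= u x)%E) ->
  (forall x, u (x + w) = u x) ->
  (\int[mu]_(x in `[b, (b + w)%R[) u x = \int[mu]_(x in `[c, (c + w)%R[) u x)%E.
Proof.
move=> w0 mu_ u0 uw.
set z := Num.floor ((b - c) / w).
have zl : c + w *~ z <= b.
  by rewrite -lerBrDl -mulrzl -ler_pdivlMr// floor_le.
have zu : b < c + w *~ z + w.
  by rewrite -addrA -{2}(mulr1z w) -mulrzDr -ltrBlDl -mulrzl -ltr_pdivrMr// floorD1_gt.
have -> : (\int[mu]_(x in `[c, (c + w)%R[) u x =
           \int[mu]_(x in `[(c + w *~ z)%R, (c + w *~ z + w)%R[) u x)%E.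
  rewrite (addrAC c) integral_shift//.
  by apply: eq_integral => x _; rewrite periodic_intmul.
move: zl zu; move: (c + _) => d db bd.
rewrite (@ge0_integral_itvco_split _ b (d + w))//; [|lra|lra].
rewrite (@ge0_integral_itvco_split _ d b)//; [|lra].
rewrite addeC; congr (_ + _)%E; rewrite integral_shift//.
by apply: eq_integral => x _; rewrite uw.
Qed.

End translation.

(** * Integral bounds *)

Section blowup.
Context d (T : measurableType d) (R : realType) (mu : {measure set T -> \bar R}).

(** By Fatou's lemma the lower limit has integral at most [c], so it is finite
almost everywhere. *)
Lemma negligible_blowup (D : set T) (W : nat -> T -> R) (c : R) : measurable D ->
  (forall N, measurable_fun setT (W N)) -> (forall N x, 0 <= W N x) ->
  (forall N, \int[mu]_(x in D) (W N x)%:E <= c%:E)%E ->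
  mu.-negligible [set x | D x /\ W ^~ x @ \oo --> +oo].
Proof.
move=> mD mW W0 Wc.
pose V N x := (W N x)%:E.
have mV N : measurable_fun D (V N).
  by apply/measurable_EFinP; apply: measurable_funTS; exact: mW.
pose G x := limn_einf (V^~ x).
have mG : measurable_fun D G.
  apply: (emeasurable_fun_cvg (fun N x => einfs (V^~ x) N)).
    exact: measurable_fun_einfs.
  by move=> x _; rewrite /G limn_einf_lim; exact: is_cvg_einfs.
have V0 N x : D x -> (0 <= V N x)%E by rewrite lee_fin.
have G0 x : D x -> (0 <= G x)%E.
  move=> Dx; rewrite /G limn_einf_lim; apply: lime_ge; first exact: is_cvg_einfs.
  by apply: nearW => N; apply: le_ereal_inf_tmp => _ [k _ <-]; exact: V0.
have GI : (\int[mu]_(x in D) G x <= c%:E)%E.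
  apply: le_trans (fatou mu mD mV V0) _.
  rewrite limn_einf_lim; apply: lime_le; first exact: is_cvg_einfs.
  apply: nearW => N; apply: le_trans (Wc N).
  by apply: ereal_inf_lbound; exists N => /=.
have iG : mu.-integrable D G.
  apply/integrableP; split=> //; under eq_integral => x xD.
    rewrite gee0_abs; last exact/G0/set_mem.
    over.
  by apply: le_lt_trans GI _; rewrite ltry.
have nG : mu.-negligible (~` [set x | D x -> G x \is a fin_num]).
  exact: integrable_ae mD _ iG.
apply: negligibleS nG => x [Dx Wx] /(_ Dx).
rewrite /G.
have [-> _] : (limn_einf (V^~ x) = +oo%E) * (limn_esup (V^~ x) = +oo%E).
  by apply: cvg_limn_einf_sup; apply/cvgeryP.
by [].
Qed.

End blowup.

Section averaging.
Context {R : realType}.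
Notation mu := (@lebesgue_measure R).

(** All translates of [w] have the same integral over an interval of length 1, so
[w] may be replaced by the average of [L] of them.  This is the conditional
expectation given the [d]-periodic sets when [w] has period [L * d]. *)
Lemma le_integral_average (w v : R -> R) (L : nat) (d b : R) : (0 < L)%N ->
  measurable_fun setT w -> measurable_fun setT v ->
  (forall x, 0 <= w x) -> (forall x, 0 <= v x) ->
  (forall x, w (x + 1) = w x) ->
  (forall x, \sum_(i < L) w (x + i%:R * d) <= L%:R * v x) ->
  (\int[mu]_(x in `[b, (b + 1)%R[) (w x)%:E <=
   \int[mu]_(x in `[b, (b + 1)%R[) (v x)%:E)%E.
Proof.
move=> L0 mw mv w0 v0 w1 wv.
have mws (t : R) : measurable_fun setT (fun x : R => w (x + t)).
  by apply: measurableT_comp => //; exact: measurable_shift.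
have L0' : (0 < L%:R :> R) by rewrite ltr0n.
rewrite -(@lee_pmul2l _ L%:R%:E) ?lte_fin//.
rewrite -[leRHS]ge0_integralZl//; [|by apply/measurable_EFinP; exact: measurable_funTS
  |by move=> x _; rewrite lee_fin].
have -> : (L%:R%:E * \int[mu]_(x in `[b, (b + 1)%R[) (w x)%:E =
    \int[mu]_(x in `[b, (b + 1)%R[) (\sum_(i < L) (w (x + i%:R * d))%:E))%E.
  rewrite ge0_integral_sum//; last 2 first.
    - by move=> i; apply/measurable_EFinP; apply: measurable_funTS; exact: mws.
    - by move=> i x _; rewrite lee_fin.
  rewrite (eq_bigr (fun=> \int[mu]_(x in `[b, (b + 1)%R[) (w x)%:E)%E).
    rewrite -[in RHS](mul1e (integral _ _ _)) -ge0_sume_distrl ?sumEFin//.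
    by rewrite sumr_const card_ord.
  move=> i _; rewrite -(@integral_shift _ (fun x => (w x)%:E))//; last first.
    exact/measurable_EFinP.
  rewrite addrAC; apply: integral_periodic => //.
    exact/measurable_EFinP.
  by move=> x; rewrite w1.
apply: ge0_le_integral => //.
- by move=> x _; apply: sume_ge0 => i _; rewrite lee_fin.
- apply: emeasurable_sum => i /=.
  by apply/measurable_EFinP; apply: measurable_funTS; exact: mws.
- by apply/measurable_EFinP; apply: measurable_funTS; exact: measurable_funM.
- by move=> x _; rewrite sumEFin -EFinM lee_fin.
Qed.

End averaging.

(** * A Borel-Cantelli lemma for periodic functions *)

Section periodic_series.
Context {R : realType} (m : nat -> nat) (h : nat -> R -> R).
Hypothesis m_homo : forall k, (m k <= m k.+1)%N.
Hypothesis h_ge0 : forall k x, 0 <= h k x.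
Hypothesis mh : forall k, measurable_fun setT (h k).
Hypothesis h_period : forall k x, h k (x + 2 ^- m k) = h k x.
Notation mu := (@lebesgue_measure R).

Let L k := (2 ^ (m k.+1 - m k))%N.
Let d k : R := 2 ^- m k.
(** The average, over the translates inside one period of [h k], of the part of
the mass that the weight [exp (- h k)] removes. *)
Let loss k x := (L k)%:R^-1 *
  \sum_(i < L k) (1 - expR (- h k (x + i%:R * d k.+1))).
Let phi k x := expR (loss k x - h k x).
Let weight a N x := \prod_(k < N) phi (a + k) x.

Let L_gt0 k : 0 < (L k)%:R :> R.
Proof. by rewrite ltr0n expn_gt0. Qed.

Let d_mulS k : (L k)%:R * d k.+1 = d k.
Proof.
rewrite /L /d natrX -{2}(subnKC (m_homo k)) exprD invfM mulrCA divff ?mulr1//.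
Qed.

Let period_le (u : R -> R) j k : (j <= k)%N -> (forall x, u (x + d k) = u x) ->
  forall x, u (x + d j) = u x.
Proof.
move=> jk uk x; have mjk : (m j <= m k)%N.
  exact: (homo_leq (r := leq) leqnn (fun y x z => @leq_trans y x z) m_homo jk).
rewrite (_ : d j = d k *~ (2 ^ (m k - m j))%N); first exact: periodic_intmul.
rewrite /d -pmulrn -[RHS]mulr_natl natrX exprB ?unitfE//.
by rewrite mulrAC divff ?mul1r// expf_neq0.
Qed.

Let period1 (u : R -> R) j : (forall x, u (x + d j) = u x) ->
  forall x, u (x + 1) = u x.
Proof.
move=> uj x; rewrite (_ : 1 = d j *~ (2 ^ m j)%N); first exact: periodic_intmul.
by rewrite /d -pmulrn -[RHS]mulr_natl natrX divff// expf_neq0.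
Qed.

Let loss_period k x : loss k (x + d k.+1) = loss k x.
Proof.
have L0 : (0 < L k)%N by rewrite expn_gt0.
rewrite /loss; congr (_ * _).
move: (d_mulS k); rewrite -(prednK L0) => dL.
rewrite big_ord_recr big_ord_recl /= addrC; congr (_ + _).
  rewrite (_ : x + d k.+1 + _ = x + d k); last by rewrite -dL -natr1; ring.
  by rewrite h_period mul0r addr0.
apply: eq_bigr => i _; congr (1 - expR (- h k _)).
by rewrite /bump/= natrD; ring.
Qed.

Let phi_period k x : phi k (x + d k) = phi k x.
Proof.
have lp : loss k (x + d k) = loss k x.
  exact: (period_le (leqnSn k) (loss_period k)).
have hp : h k (x + d k) = h k x := h_period k x.
by rewrite /phi hp lp.
Qed.

Let weight_period a N x : weight a N (x + d a) = weight a N x.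
Proof.
apply: eq_bigr => k _; apply: (period_le (leq_addr k a)) => y.
exact: phi_period.
Qed.

Let measurable_loss k : measurable_fun setT (loss k).
Proof.
apply: measurable_funM => //; apply: measurable_sum => i.
apply: measurable_funB => //; apply: measurableT_comp => //.
apply: measurableT_comp => //; apply: measurableT_comp => //.
exact: measurable_shift.
Qed.

Let measurable_phi k : measurable_fun setT (phi k).
Proof. by apply: measurableT_comp => //; exact: measurable_funB. Qed.

Let measurable_weight a N : measurable_fun setT (weight a N).
Proof. by apply: measurable_prod => k _; exact: measurable_phi. Qed.

Let weight_ge0 a N x : 0 <= weight a N x.
Proof. by apply: prodr_ge0 => k _; exact: expR_ge0. Qed.

Let weightS a N x : weight a N.+1 x = phi a x * weight a.+1 N x.
Proof.
rewrite /weight big_ord_recl addn0; congr (_ * _).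
by apply: eq_bigr => k _; rewrite /bump/= addSnnS.
Qed.

(** The average of [exp (- h k)] over the translates is [1 - loss k], and
[(1 - y) * exp y <= 1]. *)
Let sum_phi_le k x : \sum_(i < L k) phi k (x + i%:R * d k.+1) <= (L k)%:R.
Proof.
have lossE i : loss k (x + i%:R * d k.+1) = loss k x.
  by rewrite mulr_natl pmulrn; apply: periodic_intmul => y; exact: loss_period.
have -> : \sum_(i < L k) phi k (x + i%:R * d k.+1) =
    expR (loss k x) * ((L k)%:R * (1 - loss k x)).
  rewrite /phi; under eq_bigr do rewrite lossE expRD.
  rewrite -mulr_sumr; congr (_ * _); rewrite mulrBr mulr1 /loss mulrA divff.
    by rewrite mul1r sumrB sumr_const card_ord subKr.
  exact: lt0r_neq0.
rewrite mulrCA; apply: ler_piMr; first exact: ltW.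
rewrite -[leRHS](expRxMexpNx_1 (loss k x)).
by rewrite ler_pM2l ?expR_gt0//; exact: expR_ge1Dx.
Qed.

(** The product without its first factor has period [d a.+1], so averaging over
multiples of [d a.+1] acts on the first factor alone. *)
Let integral_weight_le1 a N b :
  (\int[mu]_(x in `[b, (b + 1)%R[) (weight a N x)%:E <= 1)%E.
Proof.
elim: N a => [|N IH] a.
  under eq_integral do rewrite /weight big_ord0.
  rewrite integral_cst//= mul1e lebesgue_measure_itv/= lte_fin ltrDl ltr01.
  by rewrite -EFinB addrAC subrr add0r.
apply: le_trans (IH a.+1).
apply: (@le_integral_average _ _ _ (L a) (d a.+1)) => //.
- by rewrite expn_gt0.
- by apply: (@period1 _ a) => x; exact: weight_period.
- move=> x; under eq_bigr => i _.
    rewrite weightS (_ : weight a.+1 N _ = weight a.+1 N x); last first.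
      rewrite mulr_natl pmulrn; apply: periodic_intmul => y.
      exact: weight_period.
    over.
  by rewrite -mulr_suml ler_wpM2r// sum_phi_le.
Qed.

Let loss_ge0 k x : 0 <= loss k x.
Proof.
apply: mulr_ge0; first by rewrite invr_ge0 ltW.
by apply: sumr_ge0 => i _; rewrite subr_ge0 expR_le1 oppr_le0.
Qed.

(** The weight is the exponential of the difference of the partial sums of
[loss] and of [h]; the latter are bounded. *)
Let cvg_loss x : (\sum_(k <oo) (h k x)%:E < +oo)%E ->
  ~ (weight 0 ^~ x @ \oo --> +oo) -> cvgn (series (loss ^~ x)).
Proof.
move=> hx; apply: contra_notP => ndl.
have S_homo : nondecreasing_seq (series (loss ^~ x)).
  by apply: nondecreasing_series => k _ _; exact: loss_ge0.
have /cvgryPge Soo := nondecreasing_dvgn_lt S_homo ndl.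
have hX : cvgn (series (h ^~ x)) by exact: nnseries_is_cvg.
set X := limn (series (h ^~ x)).
have leX N : series (h ^~ x) N <= X.
  by apply: nondecreasing_cvgn_le => //; exact: nondecreasing_series.
apply/cvgryPge => A; apply: filterS (Soo (A + X)) => N AN.
apply: le_trans (_ : expR A <= _).
  by apply: le_trans (expR_ge1Dx A); rewrite lerDr.
rewrite /weight /phi -expR_sum ler_expR sumrB.
under eq_bigr do rewrite add0n.
under [X in _ <= _ - X]eq_bigr do rewrite add0n.
rewrite -!(big_mkord xpredT (fun k => _ k x)).
have := leX N; move: AN; rewrite /series/=; lra.
Qed.

(** A small average bounds each of the averaged terms [1 - exp (- y)] by 1/2,
hence [y <= 1], and there [y <= 2 * (1 - exp (- y))]. *)
Let le_loss (c : R) k x : 0 < c -> (L k)%:R <= c -> loss k x <= (2 * c)^-1 ->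
  \sum_(i < L k) h k (x + i%:R * d k.+1) <= 2 * c * loss k x.
Proof.
move=> c0 Lc lc.
set H := fun i : 'I_(L k) => h k (x + i%:R * d k.+1).
have sumE : \sum_(i < L k) (1 - expR (- H i)) = (L k)%:R * loss k x.
  by rewrite /loss mulrA divff ?mul1r// lt0r_neq0.
have suml : \sum_(i < L k) (1 - expR (- H i)) <= c * loss k x.
  by rewrite sumE ler_wpM2r.
have half : c * loss k x <= 2^-1.
  by rewrite mulrC -ler_pdivlMr// -invfM.
apply: le_trans (_ : 2 * \sum_(i < L k) (1 - expR (- H i)) <= _); last first.
  by rewrite -mulrA ler_pM2l.
rewrite mulr_sumr; apply: ler_sum => i _.
have Hi : 1 - expR (- H i) <= 2^-1.
  apply: le_trans half; apply: le_trans suml.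
  rewrite (bigD1 i)//= lerDl sumr_ge0// => j _.
  by rewrite subr_ge0 expR_le1 oppr_le0; exact: h_ge0.
have e0 := expR_gt0 (- H i); have H0 : 0 <= H i by exact: h_ge0.
have : (1 + H i) * expR (- H i) <= 1.
  by rewrite -[leRHS](expRxMexpNx_1 (H i)) ler_pM2r ?expR_ge1Dx.
rewrite -/(H i); move: Hi; move: (expR _) e0 => e; nra.
Qed.

(** A convergent series of periodic functions almost surely stays convergent when
each term is replaced by the sum of its translates under the next finer period.
As at most [2^M] translates are averaged, bounds for averages give bounds for sums. *)
Lemma negligible_refined_series_dvg (M : nat) (b : R) :
  (forall k, (m k.+1 - m k <= M)%N) ->
  mu.-negligible [set x | [/\ x \in `[b, b + 1[,
    (\sum_(k <oo) (h k x)%:E < +oo)%E &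
    (\sum_(k <oo) (\sum_(i < 2 ^ (m k.+1 - m k))
       h k (x + i%:R * 2 ^- m k.+1))%:E = +oo)%E]].
Proof.
move=> gap.
have blowup : mu.-negligible
    [set x | `[b, b + 1[%classic x /\ weight 0 ^~ x @ \oo --> +oo].
  apply: (@negligible_blowup _ _ _ _ _ _ 1) => // N.
  exact: measurable_weight.
apply: negligibleS blowup => x [xb hx dvg]; split => //.
apply: contrapT => /(cvg_loss hx) cl.
set c : R := 2 ^+ M.
have c0 : 0 < c by rewrite exprn_gt0.
have Lc k : (L k)%:R <= c by rewrite /L /c natrX ler_weXn2l ?ler1n.
have [N _ lN] : \forall k \near \oo, loss k x <= (2 * c)^-1.
  have /cvgr0Pnorm_le := cvg_series_cvg_0 cl.
  move=> /(_ (2 * c)^-1); rewrite invr_gt0 mulr_gt0// => /(_ erefl).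
  by apply: filterS => k; apply: le_trans; exact: ler_norm.
move: dvg; rewrite (nneseries_split 0 N); last first.
  by move=> k _; rewrite lee_fin sumr_ge0.
rewrite add0n => dvg.
suff : (\sum_(N <= k <oo) (\sum_(i < L k) h k (x + i%:R * d k.+1))%:E < +oo)%E.
  by move: dvg; rewrite sumEFin; case: (\sum_(N <= k <oo) _)%E.
apply: le_lt_trans (_ : (2 * c)%:E * \sum_(0 <= k <oo) (loss k x)%:E < +oo)%E.
  rewrite -nneseriesZl; last by move=> k _; rewrite lee_fin.
  rewrite [leRHS](nneseries_split 0 N); last first.
    by move=> k _; rewrite lee_fin mulr_ge0// mulr_ge0// ltW.
  rewrite add0n eseries_cond [X in (_ <= _ + X)%E]eseries_cond.
  apply: le_trans (leeDr _ _); last first.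
    by apply: sume_ge0 => k _; rewrite lee_fin mulr_ge0// mulr_ge0// ltW.
  apply: lee_nneseries => k; first by rewrite lee_fin sumr_ge0.
  by move=> /= Nk; rewrite -EFinM lee_fin le_loss// lN.
rewrite (_ : (\sum_(0 <= k <oo) _)%E = limn (EFin \o series (loss ^~ x))).
  by rewrite EFin_lim// -EFinM ltry.
by congr (limn _); apply/funext => k; rewrite /series/= sumEFin.
Qed.

End periodic_series.

(** * The zero-one law for dyadic translations *)

Section zero_one.
Context {R : realType}.
Notation mu := (@lebesgue_measure R).

Lemma integral_dyadic_periodic (u : R -> \bar R) (p : nat) :
  measurable_fun setT u -> (forall x, (0 <= u x)%E) ->
  (forall q x, u (x + 2 ^- q) = u x) ->
  (\int[mu]_(x in `[0%R, 1%R[) u x =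
   (2 ^+ p)%:E * \int[mu]_(x in `[0%R, (2 ^- p)%R[) u x)%E.
Proof.
move=> mu_ u0 uq; elim: p => [|p ->]; first by rewrite expr0 invr1 mul1e.
have -> : (2 ^+ p.+1)%:E = ((2 ^+ p)%:E * 2%:E)%E :> \bar R by rewrite exprSr.
rewrite -muleA; congr (_ * _)%E.
have q0 q : 0 < 2 ^- q :> R by rewrite invr_gt0 exprn_gt0.
have qD : 2 ^- p = 2 ^- p.+1 + 2 ^- p.+1 :> R.
  by rewrite -mulr2n -[RHS]mulr_natl exprS invfM mulrA divff// mul1r.
have qS : 2 ^- p.+1 <= 2 ^- p :> R by rewrite [leRHS]qD lerDl ltW.
rewrite (@ge0_integral_itvco_split _ _ _ (2 ^- p.+1))// ?ltW//.
rewrite qD (@integral_periodic _ _ _ (2 ^- p.+1) 0)// add0r.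
have -> : 2%:E = (1 + 1)%E :> \bar R by rewrite -EFinD.
by rewrite ge0_muleDl ?mul1e.
Qed.

(** The ball has the length of one period [2^-p], so it carries the share [2^-p]
of the measure of [A] in a unit interval. *)
Lemma lebesgue_measure_dyadic_ball (A : set R) (x : R) (p : nat) :
  measurable A -> (forall q y, A (y + 2 ^- q) <-> A y) ->
  (mu (A `&` ball x (2 ^- p.+1)) * (mu (ball x (2 ^- p.+1)))^-1 =
   mu (A `&` `[0%R, 1%R[))%E.
Proof.
move=> mA Aq.
have q0 q : 0 < 2 ^- q :> R by rewrite invr_gt0 exprn_gt0.
pose u y : \bar R := (\1_A y)%:E.
have mu_ : measurable_fun setT u by apply/measurable_EFinP; exact: measurable_indic.
have u0 y : (0 <= u y)%E by rewrite lee_fin.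
have uq q y : u (y + 2 ^- q) = u y.
  rewrite /u !indicE; congr (_%:R)%:E; congr nat_of_bool.
  by apply/idP/idP; rewrite !inE => /Aq.
have uE (D : set R) : measurable D -> (mu (A `&` D) = \int[mu]_(y in D) u y)%E.
  by move=> mD; rewrite integral_indic.
have ballE : ball x (2 ^- p.+1) = `]x - 2 ^- p.+1, x + 2 ^- p.+1[%classic.
  by rewrite ball_itv.
have dbl : 2 ^- p.+1 *+ 2 = 2 ^- p :> R.
  by rewrite -[LHS]mulr_natl exprS invfM mulrA divff// mul1r.
have lenE : x + 2 ^- p.+1 = x - 2 ^- p.+1 + 2 ^- p.
  by rewrite -dbl mulr2n; ring.
rewrite lebesgue_measure_ball ?ltW// ballE !uE//.
rewrite (integral_dyadic_periodic p)//.
rewrite -(@integral_itv_bndoo _ _ _ _ true true); last exact: measurable_funTS.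
rewrite lenE (@integral_periodic _ _ _ _ 0)// add0r muleC inver; congr (_ * _)%E.
by rewrite dbl gt_eqF// invrK.
Qed.

Lemma cvg_pow2V_at_right : 2 ^- p.+1 @[p --> \oo] --> (0 : R)^'+.
Proof.
have q0 q : 0 < 2 ^- q :> R by rewrite invr_gt0 exprn_gt0.
move=> P [e /= e0 eP].
have : 2 ^- p.+1 @[p --> \oo] --> (0 : R).
  rewrite (cvg_shiftS (fun p => 2 ^- p : R)).
  under eq_fun do rewrite -exprVn.
  by apply: cvg_expr; rewrite ger0_norm ?invr_ge0// invf_lt1// ltr1n.
move=> /cvgrPdist_lt /(_ e e0); apply: filterS => p pe.
by apply: eP => //=; exact: q0.
Qed.

(** Along the radii [2^-(p+1)] the density of [A] is the same constant at every
point, and by Lebesgue's density theorem it is 0 or 1 almost everywhere. *)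
Lemma dyadic_zero_one (A : set R) : measurable A ->
  (forall q x, A (x + 2 ^- q) <-> A x) ->
  mu.-negligible A \/ mu.-negligible (~` A).
Proof.
move=> mA Aq; set alpha := mu (A `&` `[0%R, 1%R[).
have dens : mu.-negligible (~` [set x | (\1_A x)%:E = alpha]).
  have := lebesgue_density mA; apply: negligibleS => x; apply: contra_not => /= Ax.
  have := cvg_comp _ _ cvg_pow2V_at_right Ax.
  rewrite (_ : _ \o _ = cst alpha); last first.
    by apply/funext => p /=; exact: lebesgue_measure_dyadic_ball.
  by move=> /cvg_lim; rewrite lim_cst// => ->.
have [a0|a0] := eqVneq alpha 0%E; [left|right]; apply: negligibleS dens => x Ax /=.
  by rewrite indicE mem_set// a0 => -[] /eqP; rewrite oner_eq0.
by rewrite indicE memNset// => /esym/eqP; rewrite (negPf a0).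
Qed.

End zero_one.

(** * Bounded gaps, Borel functions *)

Section lattice_refinement.
Context {R : realType}.

(** Divide the numerator of a point of [2^-q Z] by [2^(q-p)] with remainder. *)
Lemma lattice_refine (p q : nat) : (p <= q)%N ->
  (lattice q : set R) `<=`
  \bigcup_(i < 2 ^ (q - p)) ((fun l => i%:R * 2 ^- q + l) @` lattice p).
Proof.
move=> pq x /latticeP[z ->].
set D := (2 ^ (q - p))%N.
have D0 : (D%:Z != 0)%R by rewrite eqz_nat /D -lt0n expn_gt0.
have r0 : (0 <= (z %% D%:Z)%Z)%R by exact: modz_ge0.
exists `|(z %% D%:Z)%Z|%N.
  have : (`|(z %% D%:Z)%Z|%N%:Z < D%:Z)%R.
    by rewrite abszE ger0_norm// ltz_pmod// ltz_nat /D expn_gt0.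
  by rewrite ltz_nat.
exists ((z %/ D%:Z)%Z%:~R / 2 ^+ p); first exact: lattice_ratio.
rewrite natr_absz ger0_norm//.
have -> : 2 ^- p = D%:R * 2 ^- q :> R.
  by rewrite /D natrX exprB ?unitfE// mulrAC divff ?mul1r// expf_neq0.
have -> : z%:~R = (z %/ D%:Z)%Z%:~R * D%:R + (z %% D%:Z)%Z%:~R :> R.
  by rewrite {1}(divz_eq z D%:Z) rmorphD rmorphM.
ring.
Qed.

End lattice_refinement.

Lemma negligible_bigcup_countable {R : realType} (I : Type) (D : set I)
    (F : I -> set R) : countable D ->
  (forall i, D i -> (@lebesgue_measure R).-negligible (F i)) ->
  (@lebesgue_measure R).-negligible (\bigcup_(i in D) F i).
Proof.
move=> /countable_injP[g ginj] nF.
have : (@lebesgue_measure R).-negligible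
    (\bigcup_k \bigcup_(i in D `&` [set i | g i = k]) F i).
  apply: negligible_bigcup => k.
  have [[i [Di gi]]|nk] := pselect (exists i, D i /\ g i = k).
    apply: negligibleS (nF i Di) => x [j [Dj gj] Fjx].
    by rewrite (ginj i j) ?inE// gi gj.
  rewrite (_ : \bigcup_(_ in _) _ = set0); first exact: negligible_set0.
  by apply/seteqP; split => // x [i [Di gi] _]; apply: nk; exists i.
by apply: negligibleS => x [i Di Fix]; exists (g i) => //; exists i.
Qed.

Section bounded_gaps.
Context {R : realType} (m n : nat -> nat) (M : nat).
Hypothesis m_pos : forall k, (0 < m k)%N.
Hypothesis n_pos : forall k, (0 < n k)%N.
Hypothesis m_incr : {homo m : i j / (i < j)%N}.
Hypothesis n_incr : {homo n : i j / (i < j)%N}.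
Hypothesis gap : forall k, (m k.+1 - m k <= M)%N.
Variable f : R -> R.
Hypothesis f_ge0 : forall x, 0 <= f x.
Hypothesis mf : measurable_fun setT f.
Notation mu := (@lebesgue_measure R).
Local Notation L := (Lambda m n : set R).

Lemma conv_set_shift p t x : lattice p t -> 0 <= t ->
  conv_set f L x -> conv_set f L (x + t).
Proof.
move=> pt t0; rewrite /conv_set /= translate_sum_shift => Lx.
have sub := Lambda_shift_sub n_pos m_incr n_incr pt t0.
apply: le_lt_trans (translate_sum_le _ f_ge0 sub) _.
apply: le_lt_trans (translate_sumU _ _ _ f_ge0) _.
rewrite lte_add_pinfty// translate_sum_finite//.
by apply: finite_image; exact: finite_Lambda.
Qed.

Section window.
Variable a : R.
(** For [x] in [[a, a + 1/2)] the points [x + l] with [l] in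
[[n_(k+1), n_(k+1) + 1/2)] lie in this window.  Its length 1 makes the windows
disjoint, and the step 1/2 leaves enough room for all the points of
[x + 2^-m_k Z] in the window to be points of [x + 1/2 + Lambda]. *)
Let J k : set R := `[(n k.+1)%:R + a, (n k.+1)%:R + a + 1[.
Let g k y := f y * \1_(J k) y.
Let S k x := translate_sum (g k) (lattice (m k)) x.
Let h k x := fine (S k x).

Let g_ge0 k y : 0 <= g k y.
Proof. by rewrite mulr_ge0// indicE ler0n. Qed.

Let hE k x : (h k x)%:E = S k x.
Proof.
rewrite /h fineK// ge0_fin_numE; last exact: translate_sum_ge0.
rewrite /S translate_sum_restrict; apply: translate_sum_finite => //.
apply: sub_finite_set (finite_lattice (m k) ((n k.+1)%:R + a - x)
  ((n k.+1)%:R + a + 1 - x)).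
move=> l [lk]; rewrite /J/= !in_itv/= => /andP[lo up].
by split => //=; rewrite ?in_itv/=; lra.
Qed.

Let S_period k x : S k (x + 2 ^- m k) = S k x.
Proof. by rewrite /S translate_sum_shift lattice_shift//; exact: lattice_step. Qed.

Let measurable_h k : measurable_fun setT (h k).
Proof.
apply: measurableT_comp => //; apply: measurable_translate_sum => //.
  exact: countable_lattice.
by apply: measurable_funM => //; apply: measurable_indic; rewrite /J.
Qed.

Let fine_window k x := lattice (m k.+1) `&` [set l | J k (x + l)].

Let trivIset_J : trivIset setT J.
Proof.
have disj i j y : (i < j)%N -> J i y -> J j y -> False.
  move=> ij; rewrite /J/= !in_itv/= => /andP[_ yi] /andP[yj _].
  have : (n i.+1)%:R + 1 <= (n j.+1)%:R :> R by rewrite natr1 ler_nat n_incr.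
  lra.
move=> i j _ _ [y [yi yj]]; case: (ltngtP i j) => // ij.
  by case: (disj _ _ _ ij yi yj).
by case: (disj _ _ _ ij yj yi).
Qed.

Let trivIset_J_lattice (p : nat -> nat) x :
  trivIset setT (fun k => lattice (p k) `&` [set l | J k (x + l)]).
Proof.
move=> i j _ _ [l [[_ li] [_ lj]]].
by apply: trivIset_J => //; exists (x + l).
Qed.

(** A point [x + l] of the window has [l - 1/2 > n_(k+1) - 1 >= n_k], which puts
[l - 1/2] into [Lambda]; [m_k > 0] is what makes 1/2 an element of the lattice. *)
Let sum_h_le x : a <= x < a + 2^-1 ->
  (\sum_(k <oo) (h k x)%:E <= translate_sum f L (x + 2^-1))%E.
Proof.
move=> /andP[ax xa].
under eq_eseriesr do rewrite hE /S translate_sum_restrict.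
rewrite -translate_sum_bigcup//.
rewrite translate_sum_shift; apply: translate_sum_le => // l [k _ [lk]].
rewrite /J/= in_itv/= => /andP[lJ _]; exists (l - 2^-1); last by rewrite addrC subrK.
apply/LambdaP => //; exists k.
  apply: latticeB => //; apply: sub_lattice (m_pos k) _ _.
  exact: (lattice_step 1).
have : (n k)%:R + 1 <= (n k.+1)%:R :> R by rewrite natr1 ler_nat n_incr.
lra.
Qed.

Let translate_sum_fine_le k x :
  (translate_sum f (fine_window k x) x <=
   (\sum_(i < 2 ^ (m k.+1 - m k)) h k (x + i%:R * 2 ^- m k.+1))%:E)%E.
Proof.
rewrite -translate_sum_restrict -sumEFin.
have mk : (m k <= m k.+1)%N by exact: ltnW (m_incr _).
apply: le_trans (translate_sum_le _ (g_ge0 k) (lattice_refine mk)) _.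
apply: le_trans (translate_sum_bigcup_ord _ _ _ (g_ge0 k)) _.
by apply: lee_sum => i _; rewrite hE /S translate_sum_shift.
Qed.

(** A point [l] of a block that stays in it when 1/2 is subtracted contributes to
the sum at [x + 1/2]; the others are within 1/2 of the left end of the block. *)
Let translate_sum_le_windows x : a <= x < a + 2^-1 ->
  (translate_sum f L x <= translate_sum f L (x + 2^-1) +
    (translate_sum f (L `&` [set l : R | (l <= (n 0)%:R + 1)%R]) x +
     \sum_(k <oo) translate_sum f (fine_window k x) x))%E.
Proof.
move=> /andP[ax xa].
rewrite translate_sum_shift -translate_sum_bigcup//; last first.
  exact: (@trivIset_J_lattice (fun k => m k.+1)).

apply: le_trans (leeD2l _ (translate_sumU _ _ _ f_ge0)).
apply: le_trans (translate_sumU _ _ _ f_ge0).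
apply: translate_sum_le => // l Ll.
have /LambdaP[//|//|//|k lk nl] := Ll.
(* The points near the left end of block [0] have no window: they are the
   finite part. *)
have [nl2|nl2] := leP ((n k)%:R + 2^-1) l.
  left; exists (l - 2^-1); last by rewrite addrC subrK.
  apply/LambdaP => //; exists k; last by lra.
  apply: latticeB => //; apply: sub_lattice (m_pos k) _ _.
  exact: (lattice_step 1).
right; case: k lk nl nl2 => [|k] lk nl nl2.
  by left; split => //=; lra.
by right; exists k => //; split => //; rewrite /J/= in_itv/=; lra.
Qed.

Lemma negligible_half_step_window :
  mu.-negligible [set x | [/\ a <= x < a + 2^-1,
    conv_set f L (x + 2^-1) & div_set f L x]].
Proof.
have m_homo k : (m k <= m k.+1)%N by exact: ltnW (m_incr _).
have h_ge0 k x : 0 <= h k x by rewrite fine_ge0// translate_sum_ge0.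
have h_period k x : h k (x + 2 ^- m k) = h k x by rewrite /h S_period.
apply: negligibleS (negligible_refined_series_dvg m_homo h_ge0
  measurable_h h_period a gap).
move=> x [xa cx dx]; split.
- by rewrite in_itv/=; move: xa; lra.
- exact: le_lt_trans (sum_h_le xa) cx.
- apply: contrapT => /eqP; rewrite -ltey => fin.
  have := translate_sum_le_windows xa; rewrite (dx : _ = +oo%E) leye_eq => /eqP.
  apply/eqP; rewrite lt_eqF// lte_add_pinfty// lte_add_pinfty//.
    by apply: translate_sum_finite => //; exact: finite_Lambda.
  apply: le_lt_trans fin; apply: lee_nneseries => k _.
    by move=> _; exact: translate_sum_ge0.
  exact: translate_sum_fine_le.
Qed.

End window.

(** Convergence propagates to the left: half-open intervals of length 1/2 with
half-integer ends cover the line, and each of them is handled by a window. *)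
Lemma negligible_half_step :
  mu.-negligible [set x | conv_set f L (x + 2^-1) /\ div_set f L x].
Proof.
have := @negligible_bigcup_countable R _ setT _ (countableP _)
  (fun z _ => negligible_half_step_window (z%:~R / 2)).
apply: negligibleS => x [cx dx].
exists (Num.floor (x * 2)) => //; split => //.
have := floor_le (x * 2); have := floorD1_gt (x * 2).
rewrite intrD; lra.
Qed.

(** The set [C'] of the points with some translate to the right by a half-integer
in [conv_set f L] is invariant under all dyadic translations, and by
[negligible_half_step] it exceeds [conv_set f L] only by a null set. *)
Lemma conv_or_div_negligible :
  mu.-negligible (conv_set f L) \/ mu.-negligible (div_set f L).
Proof.
pose C' := \bigcup_j [set x | conv_set f L (x + j%:R / 2)].
have mC : measurable (conv_set f L).
  rewrite -[X in measurable X]setTI; apply: emeasurable_fun_infty_o => //.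
  by apply: measurable_translate_sum => //; exact: countable_Lambda.
have mC' : measurable C'.
  apply: bigcupT_measurable => j.
  rewrite -[X in measurable X]setTI; exact: measurable_shift.
have C'D p t x : lattice p t -> C' x -> C' (x + t).
  move=> pt [j _ /= cj].
  set i := Num.bound (`|t| * 2).
  have ti : `|t| * 2 <= i%:R by rewrite ltW// archi_boundP// mulr_ge0.
  (* [i / 2] exceeds [|t|], so [t + i / 2] is a nonnegative dyadic. *)
  exists (j + i)%N => //=.
  rewrite (_ : x + t + _ = x + j%:R / 2 + (t + i%:R / 2)); last by rewrite natrD; ring.
  apply: (@conv_set_shift p.+1) => //.
    apply: latticeD; first exact: sub_lattice pt.
    by apply: (@sub_lattice _ 1) => //; exact: (lattice_ratio 1 i).
  by have := ler_norm (- t); rewrite normrN; lra.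
have C'step p x : C' (x + 2 ^- p) <-> C' x.
  split=> [/(C'D p _ _ (latticeN (lattice_step p)))|]; first by rewrite addrK.
  exact: C'D (lattice_step p).
have [C'0|C'1] := dyadic_zero_one mC' C'step.
  by left; apply: negligibleS C'0 => x cx; exists 0%N => //=; rewrite mul0r addr0.
right; have := negligible_bigcup (fun j =>
  negligible_shift (j%:R / 2) negligible_half_step).
move=> /(negligibleU C'1); apply: negligibleS => x dx.
have [[j _ cj]|nC'] := pselect (C' x); last by left.
right; elim: j cj => [|j IH] /= cj.
  by move: cj; rewrite mul0r addr0 /conv_set/= (dx : _ = +oo%E).
have [cj'|ncj] := pselect (conv_set f L (x + j%:R / 2)); first exact: IH.
exists j => //=; split.
  suff <- : x + j.+1%:R / 2 = x + j%:R / 2 + 2^-1 :> R by [].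
  by rewrite -natr1; lra.
by move/negP: ncj; rewrite /conv_set/div_set/= -leNgt leye_eq => /eqP.
Qed.

End bounded_gaps.

(** * Lebesgue measurable functions *)

Section lebesgue_measurable.
Context {R : realType}.
Notation mu := (@lebesgue_measure R).

(** The completed measure is the Lebesgue outer measure, also on sets that are not
measurable. *)
Lemma completed_lebesgue_measure_eq0 (A : set R) :
  completed_lebesgue_measure A = 0%E <-> mu.-negligible A.
Proof. exact: iff_sym (negligible_outer_measure A). Qed.

Lemma borel_measurable_lebesgue (f : R -> R) :
  measurable_fun setT f -> lebesgue_measurable_fun f.
Proof.
move=> mf _ Y mY; apply: sub_caratheodory.
exact: (mf measurableT _ mY).
Qed.

(** Each of the level sets [q < f] with [q] rational is Borel up to a null set, and
they determine [f]; [N] collects the countably many null sets. *)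
Lemma borel_modification (f : R -> R) : lebesgue_measurable_fun f ->
  exists N : set R, [/\ measurable N, mu N = 0%E &
    measurable_fun [set: R] (fun x => f x * \1_(~` N) x)].
Proof.
move=> mf.
have lev (q : rat) : exists A B : set R, [/\ measurable A, measurable B, mu B = 0%E &
    forall x, ~ B x -> (ratr q < f x) <-> A x].
  have : (@completed_algebra_gen _ _ R mu) (f @^-1` `]ratr q, +oo[).
    rewrite -g_sigma_completed_algebra_genE completed_caratheodory_measurable.
    have mI : measurable (`]ratr q, +oo[%classic : set R) by [].
    by have := mf measurableT _ mI; rewrite setTI.
  move=> [A mA [N [B [mB B0 NB]] fA]]; exists A, B; split => // x nB.
  have -> : (ratr q < f x) = (f @^-1` `]ratr q, +oo[) x :> Prop.
    by rewrite /= in_itv/= andbT.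
  by rewrite -fA; split=> [[//|/NB]|]; [|left].
have [A /choice[B AB]] := choice lev.
set N := \bigcup_q B q.
have mN : measurable N.
  by apply: bigcupT_measurable_rat => q; have [] := AB q.
have nN : mu.-negligible N.
  apply: negligible_bigcup_countable => // q _.
  by have [_ mB B0 _] := AB q; exact/negligibleP.
exists N; split => //; first exact/negligibleP.
apply: (measurability (@RGenOInfty.G R) (RGenOInfty.measurableE R)).
move=> _ [_ [y ->] <-]; rewrite setTI.
have -> : (fun x => f x * \1_(~` N) x) @^-1` `]y, +oo[%classic =
    (\bigcup_(q in [set q : rat | y < ratr q]) A q `&` ~` N) `|`
    (N `&` [set _ | y < 0]).
  apply/seteqP; split=> x /=; rewrite in_itv/= andbT.
    have [xN|nxN] := pselect (N x).
      by rewrite indicE memNset ?mulr0//; right.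
    rewrite indicE mem_set// mulr1 => yf; left; split => //.
    have [q] := rat_in_itvoo yf; rewrite in_itv/= => /andP[yq qf].
    exists q => //; have [_ _ _ ABq] := AB q; apply/ABq => // Bx.
    by apply: nxN; exists q.
  case=> [[[q yq Aq] nxN]|[xN y0]].
    rewrite indicE mem_set// mulr1; apply: lt_trans yq _.
    have [_ _ _ ABq] := AB q; apply/ABq => // Bx.
    by apply: nxN; exists q.
  by rewrite indicE memNset ?mulr0.
apply: measurableU.
  apply: measurableI; last exact: measurableC.
  rewrite bigcup_mkcond; apply: bigcupT_measurable_rat => q.
  by case: ifPn => // _; have [] := AB q.
have [y0|y0] := pselect (y < 0).
  by rewrite (_ : [set _ | _] = setT) ?setIT//; apply/seteqP; split.
rewrite (_ : [set _ | _] = set0) ?setI0//; apply/seteqP; split => //.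
Qed.

End lebesgue_measurable.

Section dichotomy.
Context {R : realType} (m n : nat -> nat) (M : nat).
Hypothesis m_pos : forall k, (0 < m k)%N.
Hypothesis n_pos : forall k, (0 < n k)%N.
Hypothesis m_incr : {homo m : i j / (i < j)%N}.
Hypothesis n_incr : {homo n : i j / (i < j)%N}.
Local Notation L := (Lambda m n : set R).
Notation mu := (@lebesgue_measure R).

(** Setting [f] to 0 on the null set [N] changes the sum at [x] only if [x + l]
lies in [N] for some [l], that is, for [x] in a countable union of null sets. *)
Lemma type1_of_bounded_gaps : (forall k, (m k.+1 - m k <= M)%N) -> type1 L.
Proof.
move=> gap; split; first exact: admissible_Lambda.
move=> f f0 /borel_modification[N [mN N0 mg]].
set g := fun x => f x * \1_(~` N) x in mg.
have g0 x : 0 <= g x by rewrite mulr_ge0// indicE ler0n.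
have gf x : g x <= f x.
  by rewrite /g indicE; case: (_ \in _); rewrite ?mulr1 ?mulr0.
have [Cg|Dg] := conv_or_div_negligible m_pos n_pos m_incr n_incr gap g0 mg;
    [right|left]; apply/completed_lebesgue_measure_eq0.
  apply: negligibleS Cg => x; apply: le_lt_trans.
  by apply: le_esum => l _; rewrite lee_fin.
have nN : mu.-negligible (\bigcup_(l in L) [set x | N (x + l)]).
  apply: negligible_bigcup_countable => [|l _]; first exact: countable_Lambda.
  by apply: negligible_shift; exact/negligibleP.
apply: negligibleS (negligibleU Dg nN) => x Dx.
have [Nx|nNx] := pselect ((\bigcup_(l in L) [set x | N (x + l)]) x); first by right.
left; rewrite /div_set/= -Dx; apply: eq_esum => l Ll.
rewrite /g indicE mem_set ?mulr1// => Nxl.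
by apply: nNx; exists l.
Qed.

End dichotomy.

(** * Unbounded gaps *)

Section infinite_sums.
Context {R : realType}.

Lemma finite_set_le_bound (S : set R) : finite_set S ->
  exists b : R, forall l, S l -> l <= b.
Proof.
move=> /finite_seqP[s ->]; elim: s => [|y s [b sb]]; first by exists 0.
exists (Num.max y b) => l; rewrite /= inE => /predU1P[->|/sb lb].
  by rewrite le_max lexx.
by rewrite le_max lb orbT.
Qed.

Lemma translate_sum_pinfty (f : R -> R) (L : set R) (x : R) :
  (forall y, 0 <= f y) -> infinite_set (L `&` [set l | 1 <= f (x + l)]) ->
  translate_sum f L x = +oo%E.
Proof.
move=> f0 infS; apply: eq_infty => r.
(* Finitely many, but more than [|r|], terms that are at least 1. *)
have [B BS rB] := infinite_set_fset (Num.bound `|r|) infS.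
apply: esum_ge; exists [set` B].
  by split=> [|l /BS[]//]; exact: finite_fset.
rewrite fsbig_finite//= set_fsetK sumEFin lee_fin.
apply: le_trans (_ : (size (finmap.enum_fset B))%:R <= _).
  apply: le_trans (ler_norm r) _; apply: le_trans (ltW (archi_boundP _)) _ => //.
  by rewrite ler_nat.
rewrite -sum1_size natr_sum big_seq [leRHS]big_seq; apply: ler_sum => l lB.
by have [] := BS l lB.
Qed.

End infinite_sums.

Section unbounded_gaps.
Context {R : realType} (m n : nat -> nat).
Hypothesis n_pos : forall k, (0 < n k)%N.
Hypothesis m_incr : {homo m : i j / (i < j)%N}.
Hypothesis n_incr : {homo n : i j / (i < j)%N}.
Hypothesis gap_unbounded : forall K, exists k, (K <= m k.+1 - m k)%N.
Local Notation L := (Lambda m n : set R).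
Notation mu := (@lebesgue_measure R).

(** The offset 3 makes the measures of the sets [bad j] below add up to at most
1/2, less than the length of [[1, 2)]. *)
Let gapk j := projT1 (cid (gap_unbounded (j + 3))).

Let gapkP j : (j + 3 <= m (gapk j).+1 - m (gapk j))%N.
Proof. by rewrite /gapk; case: cid. Qed.

Let gapk_large B : exists j, (B < gapk j)%N.
Proof.
exists (m B.+1); rewrite ltnNge; apply/negP => kB.
have mkB : (m (gapk (m B.+1)).+1 <= m B.+1)%N by exact: ltnW_homo.
have := gapkP (m B.+1); lia.
Qed.

(** An interval as long as the mesh of [Lambda] on its right, so that a translate
of [Lambda] cannot jump over it, but much shorter than the mesh on its left. *)
Let pulse j : set R :=
  `[(n (gapk j).+1)%:R, (n (gapk j).+1)%:R + 2 ^- m (gapk j).+1[.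
Let U := \bigcup_j pulse j.
Let f (x : R) : R := \1_U x.

Let f_ge0 x : 0 <= f x.
Proof. by rewrite /f indicE ler0n. Qed.

Let measurable_f : measurable_fun setT f.
Proof.
by apply: measurable_indic; apply: bigcupT_measurable => j; exact: measurable_itv.
Qed.

(** For [x <= 0] the translate of [Lambda] arrives at the pulse with points of
[Lambda] beyond [n_(k+1)], which has the finer mesh; and there are pulses
arbitrarily far to the right. *)
Let div_nonpos x : x <= 0 -> div_set f L x.
Proof.
move=> x0; apply: translate_sum_pinfty => // /finite_set_le_bound[b Sb].
have [j bj] := gapk_large (Num.bound `|b|).
set k := gapk j in bj.
have p0 : 0 < 2 ^+ m k.+1 :> R by rewrite exprn_gt0.
set z := Num.ceil (((n k.+1)%:R - x) * 2 ^+ m k.+1).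
set l : R := z%:~R / 2 ^+ m k.+1.
have lge : (n k.+1)%:R - x <= l by rewrite ler_pdivlMr//; exact: ceil_ge.
have llt : l < (n k.+1)%:R - x + 2 ^- m k.+1.
  rewrite ltr_pdivrMr// mulrDl mulVf ?lt0r_neq0//.
  by have := ceilB1_lt (((n k.+1)%:R - x) * 2 ^+ m k.+1); rewrite intrB -/z; lra.
have : l <= b.
  apply: Sb; split.
    by apply/LambdaP => //; exists k.+1; [exact: lattice_ratio|lra].
  rewrite /= /f indicE mem_set//; exists j => //; rewrite /pulse -/k /= in_itv/=.
  by apply/andP; split; lra.
have : (Num.bound `|b|)%:R < (n k.+1)%:R :> R.
  rewrite ltr_nat; apply: leq_trans bj _.
  exact: leq_trans (leqnSn k) (leq_of_homo_ltn n_incr _).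
have := archi_boundP (normr_ge0 b); have := ler_norm b; lra.
Qed.

Let cell j (z : nat) : set R :=
  `[z%:R / 2 ^+ m (gapk j), z%:R / 2 ^+ m (gapk j) + 2 ^- m (gapk j).+1[.
(** The points of [[0, 2)] that exceed a multiple of [2^-m_k] by less than
[2^-m_(k+1)], where [k = gapk j]. *)
Let bad j := \big[setU/set0]_(z < 2 * 2 ^ m (gapk j)) cell j z.

Let measurable_bad j : measurable (bad j).
Proof. by apply: bigsetU_measurable => z _; exact: measurable_itv. Qed.

Let mu_bad j : (mu (bad j) <= (2^-1 / (2 ^ j.+1)%:R)%:E)%E.
Proof.
set k := gapk j.
have dlen (z : nat) : mu (cell j z) = (2 ^- m k.+1)%:E.
  rewrite /cell -/k lebesgue_measure_itv/= lte_fin ltrDl invr_gt0 exprn_gt0//.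
  by rewrite -EFinB addrAC subrr add0r.
apply: le_trans (_ : \sum_(z < 2 * 2 ^ m k) mu (cell j z) <= _)%E.
  apply: (content_subadditive mu (A := bad j) (F := cell j)) => //.
    by move=> z _; exact: measurable_itv.
  exact: measurable_bad.
under eq_bigr do rewrite dlen.
rewrite sumEFin lee_fin sumr_const card_ord -[leLHS]mulr_natl.
have p0 q : 0 < 2 ^+ q :> R by rewrite exprn_gt0.
rewrite ler_pdivrMr//.
apply: le_trans (_ : 2 ^- j.+2 * 2 ^+ m k.+1 <= _); last first.
  by rewrite ler_pM2r// natrX -invfM -exprS.
rewrite ler_pdivlMl// natrM natrX -!exprS -exprD.
rewrite ler_eXn2l ?ltr1n//; have := gapkP j; rewrite -/k; lia.
Qed.

(** If [x + l] is in the pulse then [l < n_(k+1)], since [x >= 1] and the pulse is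
at most 1 long.  So [l] has denominator [2^m_k], and [x] exceeds the multiple
[n_(k+1) - l] of [2^-m_k] by less than the length of the pulse. *)
Let conv_or_bad x : 1 <= x < 2 -> conv_set f L x \/ (\bigcup_j bad j) x.
Proof.
move=> /andP[x1 x2].
have [[l [Ll]]|nL] := pselect (exists l, L l /\ U (x + l)); last first.
  left; rewrite /conv_set/= /translate_sum esum1 ?ltry// => l Ll.
  by rewrite /f indicE memNset// => Ul; apply: nL; exists l.
move=> [j _]; rewrite /pulse; set k := gapk j; rewrite /= in_itv/= => /andP[xl lx].
right; exists j => //.
have p0 q : 0 < 2 ^+ q :> R by rewrite exprn_gt0.
have le1 : 2 ^- m k.+1 <= 1 :> R by rewrite invf_le1// exprn_ege1// ler1n.
have llt : l < (n k.+1)%:R by lra.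
have [k0 lk0 nl] : exists2 k0, lattice (m k0) l & (n k0)%:R <= l.
  by apply/LambdaP.
have k0k : (k0 <= k)%N.
  rewrite leqNgt; apply/negP => kk0.
  have : (n k.+1)%:R <= (n k0)%:R :> R by rewrite ler_nat ltnW_homo.
  lra.
have : lattice (m k) ((n k.+1)%:R - l).
  apply: latticeB; first exact: (lattice_int _ (n k.+1)).
  apply: sub_lattice lk0; exact: ltnW_homo.
move=> /latticeP[z zE].
have z0 : (0 <= z)%R.
  have : 0 < z%:~R / 2 ^+ m k :> R by rewrite -zE; lra.
  by rewrite pmulr_lgt0 ?invr_gt0// ltr0z => /ltW.
have zx : z%:~R / 2 ^+ m k <= x by lra.
have zlt : (`|z| < 2 * 2 ^ m k)%N.
  rewrite -(ltr_nat R) natr_absz ger0_norm// natrM natrX -ltr_pdivrMr//.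
  exact: le_lt_trans x2.
rewrite /bad -(bigcup_mkord _ (cell j)); exists `|z|%N => //.
rewrite /cell -/k natr_absz ger0_norm// /= in_itv/= zx/=; lra.
Qed.

Lemma not_type1_of_unbounded_gaps : ~ type1 L.
Proof.
move=> [_ /(_ f f_ge0 (borel_measurable_lebesgue measurable_f))].
case=> /completed_lebesgue_measure_eq0.
  have sub : `[-1, 0]%classic `<=` div_set f L.
    by move=> x /=; rewrite in_itv/= => /andP[_]; exact: div_nonpos.
  move=> D0; have neg0 : mu.-negligible (`[-1, 0]%classic : set R).
    by apply: negligibleS D0.
  have /eqP : mu `[-1, 0]%classic = 0%E by exact: measure_negligible neg0.
  by rewrite lebesgue_measure_itv/= lte_fin ltrN10 -EFinB eqe sub0r opprK oner_eq0.
move=> [N [mN N0 CN]].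
have : (mu `[1%R, 2%R[%classic <= 2^-1%:E)%E.
  apply: le_trans (_ : \sum_(j <oo) mu (bad j `|` N) <= _)%E.
    apply: measure_sigma_subadditive => //.
      by move=> j; apply: measurableU => //; exact: measurable_bad.
    move=> x /=; rewrite in_itv/= => x12.
    have [/CN Nx|[j _ bj]] := conv_or_bad x12; first by exists 0%N => //; right.
    by exists j => //; left.
  apply: le_trans (epsilon_trick0 (eps := 2^-1) xpredT _).
    apply: lee_nneseries => // j _; rewrite measureU0 //; last exact: measurable_bad.
    exact: mu_bad.
  by rewrite invr_ge0.
by rewrite lebesgue_measure_itv/= lte_fin ltr1n -EFinB lee_fin; lra.
Qed.

End unbounded_gaps.

Lemma sup_gap_finite (R : realType) (m : nat -> nat) :
  {homo m : i j / (i < j)%N} ->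
  (sup_gap R m < +oo)%E <-> exists M, forall k, (m k.+1 - m k <= M)%N.
Proof.
move=> m_incr; have gapE k : (m k.+1)%:R - (m k)%:R = (m k.+1 - m k)%:R :> R.
  by rewrite natrB// ltnW// m_incr.
split=> [fin|[M gap]].
  have /fineK sE : sup_gap R m \is a fin_num.
    rewrite fin_numElt fin andbT; apply: lt_le_trans (ltNyr _) _.
    by apply: ereal_sup_ubound; exists 0%N.
  exists (Num.bound (fine (sup_gap R m))) => k.
  have gap_le : (m k.+1 - m k)%:R <= fine (sup_gap R m).
    by rewrite -lee_fin sE -gapE; apply: ereal_sup_ubound; exists k.
  rewrite -(ler_nat R) (le_trans gap_le)// ltW// archi_boundP//.
  exact: le_trans gap_le.
apply: (@le_lt_trans _ _ M%:R%:E); last exact: ltry.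
apply: ge_ereal_sup => _ [k _ <-].
by rewrite gapE lee_fin ler_nat.
Qed.

Theorem theorem2p3 (R : realType) (m n : nat -> nat)
  (m_pos : forall k, (0 < m k)%N) (n_pos : forall k, (0 < n k)%N)
  (m_incr : {homo m : i j / (i < j)%N}) (n_incr : {homo n : i j / (i < j)%N}) :
  type1 (Lambda m n : set R) <-> (sup_gap R m < +oo)%E.
Proof.
rewrite sup_gap_finite//; split=> [t1|[M gap]]; last exact: type1_of_bounded_gaps gap.
apply: contrapT => unbounded.
apply: (@not_type1_of_unbounded_gaps R m n) t1 => // K.
apply: contrapT => noK; apply: unbounded; exists K => k.
by rewrite leqNgt; apply/negP => /ltnW Kk; apply: noK; exists k.
Qed.
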